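(* Let $G$ be a connected finite simple graph with $n$ vertices, without isolated vertices, and with vertex bipartiteness $\upsilon_b(G)$. Then $$s_Q(G)\ \ge\ 2\lambda_1(G)-\upsilon_b(G).$$ Equality holds if $G$ is a regular bipartite graph.
   Context: For a finite simple graph $G$ on $n$ vertices, let $A_G$ be its adjacency matrix, with largest eigenvalue $\lambda_1(G)$, and $D_G$ the diagonal matrix of vertex degrees. The signless Laplacian matrix is $Q_G=D_G+A_G$ with eigenvalues $q_1\ge q_2\ge\cdots\ge q_n$, and the signless Laplacian spread is $s_Q(G)=q_1-q_n$. The vertex bipartiteness $\upsilon_b(G)$ is the minimum number of vertices of $G$ whose deletion yields a bipartite graph (so $\upsilon_b(G)=0$ if $G$ is bipartite). *)

(* Defs.v *)
From mathcomp Require Import all_boot all_order all_algebra.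
From mathcomp Require Import polyrcf complex.

Set Implicit Arguments.
Unset Strict Implicit.
Unset Printing Implicit Defensive.

Import Order.TTheory GRing.Theory Num.Theory.

Local Open Scope ring_scope.

(* A finite simple graph on the finite vertex type T is given by its adjacency
   relation e : rel T, assumed symmetric and irreflexive where it is used. *)

(* The graph without vertices is not counted as connected. *)
Definition connected (T : finType) (e : rel T) : bool :=
  (0 < #|T|)%N && [forall x, forall y, connect e x y].

Definition degree (T : finType) (e : rel T) (x : T) : nat := #|[set y | e x y]|.

Definition isolated (T : finType) (e : rel T) (x : T) : bool :=
  degree e x == 0%N.

Definition regular (T : finType) (e : rel T) : bool :=
  [forall x, forall y, degree e x == degree e y].

Definition bipartite (T : finType) (e : rel T) : bool :=
  [exists A : {set T}, forall x, forall y, e x y ==> ((x \in A) != (y \in A))].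

Definition delete_vertices (T : finType) (e : rel T) (S : {set T}) :
    rel {x : T | x \notin S} :=
  fun x y => e (val x) (val y).

Lemma bipartite_deleteT (T : finType) (e : rel T) :
  bipartite (delete_vertices e (S := setT)).
Proof.
by apply/existsP; exists set0; apply/forallP => -[x hx]; case/negP: (hx); rewrite inE.
Qed.

Definition vertex_bipartiteness (T : finType) (e : rel T) : nat :=
  #|[arg min_(S < [set: T] | bipartite (delete_vertices e (S := S))) #|S|]|.

Lemma vertex_bipartiteness_min (T : finType) (e : rel T) :
  (exists2 S : {set T},
     bipartite (delete_vertices e (S := S)) & #|S| = vertex_bipartiteness e) /\
  (forall S : {set T}, bipartite (delete_vertices e (S := S)) ->
     (vertex_bipartiteness e <= #|S|)%N).
Proof.
rewrite /vertex_bipartiteness; case: arg_minnP => [|S bS minS].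
  exact: bipartite_deleteT.
by split; [exists S | exact: minS].
Qed.

Definition adjacency_mx (R : pzRingType) (n : nat) (e : rel 'I_n) : 'M[R]_n :=
  \matrix_(i, j) (e i j)%:R.

Definition signless_laplacian (R : pzRingType) (n : nat) (e : rel 'I_n) :
    'M[R]_n :=
  diag_mx (\row_i (degree e i)%:R) + adjacency_mx R e.

(* All eigenvalues in R of a square matrix, in decreasing order and repeated
   according to their algebraic multiplicity; rootsR lists the distinct roots
   of a polynomial in increasing order. *)
Definition spectrum (R : rcfType) (n : nat) (A : 'M[R]_n) : seq R :=
  let p := char_poly A in
  flatten [seq nseq (mup x p) x | x <- rev (rootsR p)].

Lemma sorted_spectrum (R : rcfType) (n : nat) (A : 'M[R]_n) :
  sorted >=%R (spectrum A).
Proof.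
rewrite /spectrum; set p := char_poly A.
have : sorted >%R (rev (rootsR p)).
  by rewrite rev_sorted sorted_roots.
have ge_tr : transitive (>=%R : rel R).
  by move=> u v w le_uv le_wu; apply: le_trans le_wu le_uv.
elim: (rev _) => //= x s IHs; rewrite path_sortedE; last first.
  by move=> u v w lt_uv lt_wu; apply: lt_trans lt_wu lt_uv.
case/andP=> gt_x /IHs; rewrite !sorted_pairwise // pairwise_cat => ->.
rewrite andbT; apply/andP; split.
  apply/allrelP => y z; rewrite mem_nseq => /andP[_ /eqP ->].
  case/flatten_mapP => t /(allP gt_x) lt_tx; rewrite mem_nseq.
  by case/andP=> _ /eqP ->; apply: ltW.
by elim: (mup _ _) => //= m ->; rewrite andbT all_nseq /= lexx orbT.
Qed.

Lemma char_poly_conj (F : fieldType) (n : nat) (P B : 'M[F]_n) :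
  P \in unitmx -> char_poly (invmx P *m B *m P) = char_poly B.
Proof.
move=> uP; have PV : map_mx polyC (invmx P) *m map_mx polyC P = 1%:M.
  by rewrite -map_mxM mulVmx // map_mx1.
have -> : char_poly (invmx P *m B *m P) =
    \det (map_mx polyC (invmx P) *m char_poly_mx B *m map_mx polyC P).
  rewrite /char_poly /char_poly_mx !map_mxM mulmxBr mulmxBl.
  by rewrite mul_mx_scalar -scalemxAl PV scalemx1.
by rewrite !det_mulmx mulrAC -det_mulmx PV det1 mul1r.
Qed.

Lemma char_poly_splits (R : rcfType) (n : nat) (A : 'M[R]_n) : A^T = A ->
  exists s : seq R, char_poly A = \prod_(x <- s) ('X - x%:P).
Proof.
move=> symA; pose f : {rmorphism R -> R[i]} := real_complex R.
have herm : map_mx f A \is hermsymmx.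
  apply: realsym_hermsym.
    by apply/is_hermitianmxP; rewrite expr0 scale1r map_mx_id // map_trmx symA.
  by apply/mxOverP => i j; rewrite mxE; apply/complex_realP; exists (A i j).
have real := hermitian_spectral_diag_real herm.
have /hermitian_normalmx /orthomx_spectralP specA := herm.
pose d := spectral_diag (map_mx f A).
exists [seq complex.Re (d 0 i) | i <- enum 'I_n].
apply: (map_poly_inj f); rewrite map_char_poly specA.
rewrite char_poly_conj ?spectral_unit // char_poly_trig ?diag_mx_is_trig //.
rewrite rmorph_prod big_map big_enum /=; apply: eq_bigr => i _.
rewrite map_polyXsubC mxE eqxx mulr1n; congr ('X - _%:P).
by apply/esym/RRe_real; apply: (mxOverP real).
Qed.

Lemma char_poly_spectrum (R : rcfType) (n : nat) (A : 'M[R]_n) : A^T = A ->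
  char_poly A = \prod_(x <- spectrum A) ('X - x%:P).
Proof.
move=> /char_poly_splits[s ps]; rewrite {1}ps; apply: perm_big.
have p_neq0 : char_poly A != 0 by rewrite monic_neq0 ?char_poly_monic.
apply/allP => x _ /=; apply/eqP.
rewrite -mu_prod_XsubC -ps /spectrum; set p := char_poly A.
have root_mem y : (y \in rev (rootsR p)) = root p y.
  by rewrite mem_rev -(roots_on_rootsR p_neq0) inE.
have urs : uniq (rev (rootsR p)) by rewrite rev_uniq uniq_roots.
rewrite count_flatten -map_comp.
under eq_map => y do rewrite /= count_nseq /= .
have [px|npx] := boolP (root p x).
  rewrite sumnE big_map (bigD1_seq x) ?root_mem //= eqxx mul1n big1 ?addn0 //.
  by move=> y /negPf ->.
rewrite mupNroot // sumnE big_map big_seq big1 // => y; rewrite root_mem => py.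
by case: eqP py npx => [->|] // ->.
Qed.

Lemma size_spectrum (R : rcfType) (n : nat) (A : 'M[R]_n) : A^T = A ->
  size (spectrum A) = n.
Proof.
move=> /char_poly_spectrum/(congr1 (fun p : {poly R} => size p)).
by rewrite size_char_poly size_prod_XsubC => -[].
Qed.

(* The k-th largest eigenvalue, counted from 1. For symmetric A the spectrum has
   n elements (size_spectrum), so the default value is not reached if
   1 <= k <= n. *)
Definition eigval (R : rcfType) (n : nat) (A : 'M[R]_n) (k : nat) : R :=
  (spectrum A)`_k.-1.

Definition signless_spread (R : rcfType) (n : nat) (e : rel 'I_n) : R :=
  let Q := signless_laplacian R e in eigval Q 1 - eigval Q n.

(* Main.v *)
(* Q satisfies 2 x Q x^T = \sum_(i, j) e_ij (x_i + x_j)^2. Evaluated at a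
   lambda_1-eigenvector of A, (a + b)^2 >= 4 a b gives q_1 >= 2 lambda_1. If S
   is a minimum set whose deletion leaves a bipartite graph, the vector which is
   0 on S and +1 or -1 on the two colour classes only sees the edges between S
   and its complement, at most #|S| * #|~: S| of them, so that q_n <= #|S|. For a
   d-regular bipartite graph, q_n >= 0 and q_1 <= 2 d <= 2 lambda_1 give the
   converse. *)
Require Import Defs.
From mathcomp Require Import all_boot all_order all_algebra.
From mathcomp Require Import complex ring lra.

Set Implicit Arguments.
Unset Strict Implicit.
Unset Printing Implicit Defensive.

Import Order.TTheory GRing.Theory Num.Theory.

Local Open Scope ring_scope.

(** * Quadratic forms of real symmetric matrices and their extreme eigenvalues *)

Section QuadraticForm.

Variables (R : rcfType) (n : nat).
Implicit Types (A : 'M[R]_n) (x : 'rV[R]_n).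

Definition quad_form A x : R := (x *m A *m x^T) 0 0.

Lemma quad_formE A x : quad_form A x = \sum_i \sum_j A i j * (x 0 i * x 0 j).
Proof.
rewrite /quad_form mxE exchange_big; apply: eq_bigr => j _ /=.
by rewrite !mxE mulr_suml; apply: eq_bigr => i _; rewrite mulrCA mulrA.
Qed.

Lemma dotmxE x : (x *m x^T) 0 0 = \sum_i x 0 i ^+ 2.
Proof. by rewrite mxE; apply: eq_bigr => i _; rewrite mxE expr2. Qed.

Lemma dotmx_gt0 x : x != 0 -> 0 < (x *m x^T) 0 0.
Proof.
move=> x_neq0; rewrite dotmxE lt0r sumr_ge0 => [|i _]; last exact: sqr_ge0.
rewrite andbT psumr_eq0 => [|i _]; last exact: sqr_ge0.
apply: contra x_neq0 => /allP x0; apply/eqP/rowP => i; rewrite mxE.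
by have := x0 i (mem_index_enum i); rewrite sqrf_eq0 => /eqP.
Qed.

(* w i is the squared modulus of the i-th coordinate of x in a unitary
   eigenbasis, which the library only provides over R[i]. *)
Lemma quad_form_eigen A x : A^T = A ->
  exists d w : 'I_n -> R,
    [/\ forall i, root (char_poly A) (d i), forall i, 0 <= w i,
        quad_form A x = \sum_i d i * w i & (x *m x^T) 0 0 = \sum_i w i].
Proof.
move=> symA; pose f : {rmorphism R -> R[i]} := real_complex R.
have herm : map_mx f A \is hermsymmx.
  apply: realsym_hermsym.
    by apply/is_hermitianmxP; rewrite expr0 scale1r map_mx_id // map_trmx symA.
  by apply/mxOverP => i j; rewrite mxE; apply/complex_realP; exists (A i j).
have real := hermitian_spectral_diag_real herm.
have /hermitian_normalmx /orthomx_spectralP := herm.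
set P := spectralmx _; set D := spectral_diag _ => /= specA.
have uP : P \is unitarymx by apply: spectral_unitarymx.
have iP : invmx P = map_mx Num.conj P^T by rewrite invmx_unitary.
have conj_real m k (B : 'M[R]_(m, k)) :
    map_mx Num.conj (map_mx f B) = map_mx f B.
  apply/matrixP => i j; rewrite !mxE; apply/CrealP.
  by apply/complex_realP; exists (B i j).
have fReD i : f (complex.Re (D 0 i)) = D 0 i.
  by apply: RRe_real; apply: (mxOverP real).
pose u := map_mx f x *m invmx P.
(* As [x] is real and [P] unitary, [P] applied to the column of [x] is the conjugate transpose of
   [u]. So [x *m A *m x^T] becomes the diagonal form [D] evaluated at [u]. *)
have uC : P *m map_mx f x^T = map_mx Num.conj u^T.
  rewrite /u iP trmx_mul map_mxM; congr (_ *m _); last first.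
    by rewrite -[LHS]conj_real map_trmx.
  by apply/matrixP => i j; rewrite !mxE; apply: esym; apply: conjCK.
have uCE i : map_mx Num.conj u^T i 0 = (u 0 i)^* by rewrite !mxE.
have uDE i : (u *m diag_mx D) 0 i = u 0 i * D 0 i by rewrite mul_mx_diag mxE.
pose w i := `|u 0 i| ^+ 2.
have fReW i : f (complex.Re (w i)) = w i.
  by apply/RRe_real/ger0_real/exprn_ge0.
exists (fun i => complex.Re (D 0 i)), (fun i => complex.Re (w i)); split.
- move=> i; rewrite -(fmorph_root f) fReD map_char_poly specA.
  rewrite char_poly_conj ?spectral_unit // char_poly_trig ?diag_mx_is_trig //.
  by rewrite rootE horner_prod prodf_seq_eq0; apply/hasP; exists i;
    rewrite ?mem_index_enum //= hornerXsubC mxE eqxx mulr1n subrr.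
- by move=> i; rewrite -lecR fReW exprn_ge0.
- apply: (fmorph_inj f); rewrite rmorph_sum /=.
  transitivity ((u *m diag_mx D *m map_mx Num.conj u^T) 0 0).
    transitivity ((map_mx f (x *m A *m x^T)) 0 0); first by rewrite [RHS]mxE.
    by rewrite !map_mxM specA -uC !mulmxA.
  rewrite mxE; apply: eq_bigr => i _.
  transitivity (f (complex.Re (D 0 i)) * f (complex.Re (w i))).
    by rewrite fReD fReW /w normCK uCE uDE mulrAC mulrC.
  by rewrite rmorphM.
- apply: (fmorph_inj f); rewrite rmorph_sum /=.
  transitivity ((u *m map_mx Num.conj u^T) 0 0).
    transitivity ((map_mx f (x *m x^T)) 0 0); first by rewrite [RHS]mxE.
    by rewrite map_mxM -uC mulmxA mulmxKV // unitarymx_unit.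
  by rewrite mxE; apply: eq_bigr => i _; rewrite [RHS]fReW uCE /w normCK.
Qed.

Lemma root_spectrum A a : A^T = A -> root (char_poly A) a = (a \in spectrum A).
Proof. by move=> symA; rewrite char_poly_spectrum // root_prod_XsubC. Qed.

Lemma eigval_bounds A a : A^T = A -> root (char_poly A) a ->
  eigval A n <= a <= eigval A 1.
Proof.
move=> symA; rewrite root_spectrum // => a_in.
have sA := size_spectrum symA; have lt_an := a_in.
(* The index of [a] is below [n], so [n] is positive and position [n.-1] holds a genuine eigenvalue,
   not the default [0]. *)
rewrite -index_mem sA in lt_an; have n_gt0 := leq_ltn_trans (leq0n _) lt_an.
have ge_tr : transitive (>=%R : rel R).
  by move=> u v w le_uv le_wu; apply: le_trans le_wu le_uv.
have mono := sorted_leq_nth ge_tr (@lexx _ R) 0 (sorted_spectrum A).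
rewrite -[a](nth_index 0 a_in) /eigval.
by apply/andP; split; apply: mono; rewrite ?inE ?sA ?prednK // -ltnS prednK.
Qed.

(** Rayleigh bounds: the form is a combination of eigenvalues whose nonnegative weights add up to
    the squared norm of [x]. *)
Lemma quad_form_bounds A x : A^T = A ->
  eigval A n * (x *m x^T) 0 0 <= quad_form A x <= eigval A 1 * (x *m x^T) 0 0.
Proof.
move=> symA; have [d [w [rd w0 -> ->]]] := quad_form_eigen x symA.
rewrite !mulr_sumr; apply/andP; split; apply: ler_sum => i _;
  by have /andP[] := eigval_bounds symA (rd i); move=> *; rewrite ler_wpM2r.
Qed.

Lemma eigval_eigenvector A k : A^T = A -> (0 < k <= n)%N ->
  exists2 x, x != 0 & quad_form A x = eigval A k * (x *m x^T) 0 0.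
Proof.
move=> symA /andP[k_gt0 le_kn].
have : eigenvalue A (eigval A k).
  rewrite eigenvalue_root_char root_spectrum // mem_nth // size_spectrum //.
  by rewrite prednK.
by case/eigenvalueP => x xA x_neq0; exists x; rewrite // /quad_form xA -scalemxAl mxE.
Qed.

End QuadraticForm.

(** * Eigenvalue estimates for the adjacency and signless Laplacian matrices *)

Section Graph.

Variables (R : rcfType) (n : nat) (e : rel 'I_n).
Hypothesis e_sym : symmetric e.

Local Notation A := (adjacency_mx R e).
Local Notation Q := (signless_laplacian R e).

Lemma tr_adjacency : A^T = A.
Proof. by apply/matrixP => i j; rewrite !mxE e_sym. Qed.

Lemma tr_signless_laplacian : Q^T = Q.
Proof. by rewrite linearD /= tr_diag_mx tr_adjacency. Qed.

Lemma natr_degree i : (degree e i)%:R = \sum_j (e i j)%:R :> R.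
Proof.
rewrite /degree -sum1_card natr_sum big_mkcond.
by apply: eq_bigr => j _; rewrite inE; case: (e i j).
Qed.

Lemma quad_form_adjacency (x : 'rV[R]_n) :
  quad_form A x = \sum_i \sum_j (e i j)%:R * (x 0 i * x 0 j).
Proof.
by rewrite quad_formE; apply: eq_bigr => i _; apply: eq_bigr => j _; rewrite mxE.
Qed.

Lemma quad_form_degree (x : 'rV[R]_n) :
  quad_form (diag_mx (\row_i (degree e i)%:R)) x =
    \sum_i \sum_j (e i j)%:R * x 0 i ^+ 2.
Proof.
rewrite quad_formE; apply: eq_bigr => i _.
rewrite -mulr_suml -natr_degree (bigD1 i) //= !mxE eqxx mulr1n -expr2.
by rewrite big1 ?addr0 // => j /negPf ji; rewrite !mxE eq_sym ji mulr0n mul0r.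
Qed.

(** By symmetry of [e], the square may sit at either end of an edge. Adding both versions
    symmetrises sums over ordered pairs. *)
Lemma quad_form_degreeC (x : 'rV[R]_n) :
  quad_form (diag_mx (\row_i (degree e i)%:R)) x =
    \sum_i \sum_j (e i j)%:R * x 0 j ^+ 2.
Proof.
rewrite quad_form_degree exchange_big; apply: eq_bigr => i _.
by apply: eq_bigr => j _; rewrite e_sym.
Qed.

Lemma quad_form_signless_laplacian (x : 'rV[R]_n) :
  2 * quad_form Q x = \sum_i \sum_j (e i j)%:R * (x 0 i + x 0 j) ^+ 2.
Proof.
have -> : quad_form Q x =
    quad_form (diag_mx (\row_i (degree e i)%:R)) x + quad_form A x.
  by rewrite /quad_form mulmxDr mulmxDl mxE.
(* The factor 2 supplies two copies of the degree form, one for the square of each endpoint; the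
   adjacency form supplies the cross term. *)
rewrite mulrDr [X in X + _]mulr_natl mulr2n {1}quad_form_degreeC quad_form_degree.
rewrite quad_form_adjacency mulr_sumr -!big_split; apply: eq_bigr => i _ /=.
rewrite mulr_sumr -!big_split; apply: eq_bigr => j _ /=; ring.
Qed.

Lemma signless_laplacian_ge_adjacency : (0 < n)%N ->
  2 * eigval A 1 <= eigval Q 1.
Proof.
move=> n_gt0; have [|x x_neq0 xA] := @eigval_eigenvector _ _ A 1 tr_adjacency.
  by [].
have /andP[_ xQ] := quad_form_bounds x tr_signless_laplacian.
rewrite -(ler_pM2r (dotmx_gt0 x_neq0)) -mulrA -xA; apply: le_trans xQ.
rewrite -(ler_pM2l (ltr0n R 2)) quad_form_signless_laplacian quad_form_adjacency.
rewrite !mulr_sumr; apply: ler_sum => i _; rewrite !mulr_sumr.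
apply: ler_sum => j _; have : 0 <= (e i j)%:R :> R by rewrite ler0n.
have := sqr_ge0 (x 0 i - x 0 j); nra.
Qed.

(** At an eigenvector for the least eigenvalue, twice the form is a sum of squares with nonnegative
    coefficients. *)
Lemma min_signless_laplacian_ge0 : (0 < n)%N -> 0 <= eigval Q n.
Proof.
move=> n_gt0.
have [|x x_neq0 xQ] := @eigval_eigenvector _ _ Q n tr_signless_laplacian.
  by rewrite n_gt0 /=.
rewrite -(pmulr_lge0 _ (dotmx_gt0 x_neq0)) -xQ -(pmulr_rge0 _ (ltr0n R 2)).
rewrite quad_form_signless_laplacian; apply: sumr_ge0 => i _.
by apply: sumr_ge0 => j _; rewrite mulr_ge0 ?ler0n ?sqr_ge0.
Qed.

(** Since (a + b)^2 <= 2 (a^2 + b^2), the form of [Q] is at most twice the degree form, which for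
    constant degree is [d] times the squared norm. *)
Lemma max_signless_laplacian_regular d : (0 < n)%N ->
  (forall i, degree e i = d) -> eigval Q 1 <= 2 * d%:R.
Proof.
move=> n_gt0 deg.
have [|x x_neq0 xQ] := @eigval_eigenvector _ _ Q 1 tr_signless_laplacian.
  by [].
rewrite -(ler_pM2r (dotmx_gt0 x_neq0)) -xQ -(ler_pM2l (ltr0n R 2)).
have degE : quad_form (diag_mx (\row_i (degree e i)%:R)) x =
    d%:R * (x *m x^T) 0 0.
  rewrite quad_form_degree dotmxE mulr_sumr; apply: eq_bigr => i _.
  by rewrite -mulr_suml -natr_degree deg.
have -> : 2 * (2 * d%:R * (x *m x^T) 0 0) =
    \sum_i \sum_j (e i j)%:R * (2 * (x 0 i ^+ 2 + x 0 j ^+ 2)).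
  transitivity (2 * (d%:R * (x *m x^T) 0 0 + d%:R * (x *m x^T) 0 0) : R).
    by ring.
  rewrite -degE {1}quad_form_degree quad_form_degreeC -big_split mulr_sumr.
  apply: eq_bigr => i _ /=; rewrite -big_split mulr_sumr.
  by apply: eq_bigr => j _ /=; ring.
rewrite quad_form_signless_laplacian.
apply: ler_sum => i _; apply: ler_sum => j _; rewrite ler_wpM2l ?ler0n //.
have := sqr_ge0 (x 0 i - x 0 j); nra.
Qed.

(** The all-ones vector has Rayleigh quotient [d]. *)
Lemma max_adjacency_regular d : (0 < n)%N ->
  (forall i, degree e i = d) -> d%:R <= eigval A 1.
Proof.
move=> n_gt0 deg; pose x : 'rV[R]_n := const_mx 1.
have xx : (x *m x^T) 0 0 = n%:R.
  rewrite dotmxE; under eq_bigr do rewrite mxE expr1n.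
  by rewrite sumr_const card_ord.
have /andP[_] := quad_form_bounds x tr_adjacency.
have -> : quad_form A x = d%:R * n%:R.
  rewrite quad_form_adjacency; under eq_bigr => i _.
    under eq_bigr do rewrite !mxE !mulr1.
    rewrite -natr_degree deg; over.
  by rewrite sumr_const card_ord mulr_natr.
by rewrite xx ler_pM2r // ltr0n.
Qed.

Lemma min_signless_laplacian_le (S B : {set 'I_n}) : (#|S| < n)%N ->
  (forall i j, i \notin S -> j \notin S -> e i j -> (i \in B) != (j \in B)) ->
  eigval Q n <= #|S|%:R.
Proof.
move=> ltSn bip.
pose x : 'rV[R]_n := \row_i if i \in S then 0 else (-1) ^+ (i \in B).
have xx : (x *m x^T) 0 0 = #|~: S|%:R.
  rewrite dotmxE -sum1_card natr_sum [RHS]big_mkcond.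
  apply: eq_bigr => i _; rewrite mxE inE.
  by case: (i \in S); rewrite ?expr0n // -exprM mulnC exprM sqrrN !expr1n.
(* The bound [#|S| < n] makes the test vector nonzero, so its squared norm can be cancelled. *)
have ST_gt0 : 0 < #|~: S|%:R :> R.
  by rewrite ltr0n -(ltn_add2l #|S|) addn0 cardsC card_ord.
have /andP[] := quad_form_bounds x tr_signless_laplacian.
rewrite xx => le_q _; rewrite -(ler_pM2r ST_gt0); apply: le_trans le_q _.
rewrite -(ler_pM2l (ltr0n R 2)) quad_form_signless_laplacian.
(* Ordered pairs meet each edge of the cut twice, so the doubled bound is written as two sums, one
   for each choice of the endpoint in [S], and compared termwise. *)
have cut : #|S|%:R * #|~: S|%:R =
    \sum_i \sum_j (i \in S)%:R * (j \notin S)%:R :> R.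
  rewrite -!sum1_card !natr_sum [X in X * _]big_mkcond mulr_suml.
  apply: eq_bigr => i _; rewrite [X in _ * X]big_mkcond mulr_sumr.
  by apply: eq_bigr => j _; rewrite inE; do 2!case: (_ \in S).
have cutC : #|S|%:R * #|~: S|%:R =
    \sum_i \sum_j (j \in S)%:R * (i \notin S)%:R :> R.
  by rewrite cut exchange_big.
rewrite [X in _ <= X]mulr_natl mulr2n {1}cut cutC -big_split.
apply: ler_sum => i _ /=; rewrite -big_split; apply: ler_sum => j _ /=.
rewrite !mxE; have := bip i j.
(* Inside [S] both entries vanish; across the cut the square is 1; outside [S] the two ends of an
   edge carry opposite signs and cancel. *)
case: (i \in S); case: (j \in S); [move=> _|move=> _|move=> _|move=> /(_ isT isT)] => /=.
- by rewrite addr0 expr0n /= mulr0; lra.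
- by case: (e i j); case: (j \in B); rewrite /= ?expr0 ?expr1; lra.
- by case: (e i j); case: (i \in B); rewrite /= ?expr0 ?expr1; lra.
case: (e i j) => [/(_ isT)|_]; last by rewrite mul0r; lra.
by case: (i \in B); case: (j \in B) => //= _; rewrite ?expr0 ?expr1; lra.
Qed.

End Graph.

(** * Vertex bipartiteness *)

Lemma bipartite_delete_set (T : finType) (e : rel T) (S : {set T}) :
  bipartite (delete_vertices e (S := S)) ->
  exists B : {set T}, forall x y, x \notin S -> y \notin S -> e x y ->
    (x \in B) != (y \in B).
Proof.
case/existsP => B /forallP bB; exists [set val x | x in B] => x y xS yS exy.
have /forallP/(_ (exist _ y yS))/implyP/(_ exy) := bB (exist _ x xS).
by rewrite -!(mem_imset _ _ val_inj).
Qed.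

(** A single vertex without a loop is bipartite, so all vertices but one may be deleted. Strictness
    ensures that a minimum deletion set has a nonempty complement. *)
Lemma vertex_bipartiteness_lt (T : finType) (e : rel T) :
  irreflexive e -> (0 < #|T|)%N -> (vertex_bipartiteness e < #|T|)%N.
Proof.
move=> irr T_gt0; have [_ minb] := vertex_bipartiteness_min e.
have [x _] := card_gt0P T_gt0.
have bS : bipartite (delete_vertices e (S := [set~ x])).
  apply/existsP; exists set0; apply/forallP => y; apply/forallP => z.
  have eq_x (u : {u | u \notin [set~ x]}) : val u = x.
    by have := valP u; rewrite !inE negbK => /eqP.
  by rewrite /delete_vertices !eq_x irr.
by apply: leq_ltn_trans (minb _ bS) _; rewrite cardsC1 prednK.
Qed.

Lemma vertex_bipartiteness_bipartite (T : finType) (e : rel T) :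
  bipartite e -> vertex_bipartiteness e = 0%N.
Proof.
move=> /existsP[B /forallP bB]; have [_ minb] := vertex_bipartiteness_min e.
apply/eqP; rewrite -leqn0 -(cards0 T); apply: minb.
apply/existsP; exists [set x | val x \in B]; apply/forallP => x; apply/forallP => y.
by rewrite !inE; have /forallP := bB (val x); apply.
Qed.

Theorem theorem12 (R : rcfType) (n : nat) (e : rel 'I_n)
    (e_sym : symmetric e) (e_irrefl : irreflexive e)
    (e_connected : connected e) (e_no_isolated : forall x : 'I_n, ~~ isolated e x) :
  signless_spread R e >=
    2 * eigval (adjacency_mx R e) 1 - (vertex_bipartiteness e)%:R
  /\ (regular e -> bipartite e ->
      signless_spread R e =
        2 * eigval (adjacency_mx R e) 1 - (vertex_bipartiteness e)%:R).
Proof.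
have /andP[T_gt0 _] := e_connected.
have n_gt0 : (0 < n)%N by rewrite -(card_ord n).
have lower : signless_spread R e >=
    2 * eigval (adjacency_mx R e) 1 - (vertex_bipartiteness e)%:R.
  have ltb := vertex_bipartiteness_lt e_irrefl T_gt0.
  have [[S /bipartite_delete_set[B bB] cS] _] := vertex_bipartiteness_min e.
  rewrite -cS card_ord in ltb *.
  apply: lerB; first exact: signless_laplacian_ge_adjacency.
  exact: min_signless_laplacian_le bB.
split=> // reg bip; apply/eqP; rewrite eq_le lower andbT.
(* Vertex 0 serves as the reference for the common degree. *)
have deg i : degree e i = degree e (Ordinal n_gt0).
  by have /forallP/(_ i)/forallP/(_ (Ordinal n_gt0))/eqP := reg.
rewrite vertex_bipartiteness_bipartite //.
(* The subtracted bipartiteness is now 0, so it is compared with the nonnegative least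
   eigenvalue. *)
apply: lerB; last exact: min_signless_laplacian_ge0.
apply: le_trans (max_signless_laplacian_regular R e_sym n_gt0 deg) _.
by rewrite ler_pM2l ?ltr0n //; apply: max_adjacency_regular deg.
Qed.
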